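(* Let $G=(V,E)$ be a finite connected graph, let $Q\in\mathbb{R}^V$, let $H_Q=\Delta_G+Q$, and let $T>0$. Assume that $H_Q$ satisfies Conditions $B_2$, (I) and (S). Then $H_Q$ does Schrödinger phase retrieval: whenever $u_0,v_0\in\mathbb{C}^V$ satisfy $|(e^{-itH_Q}u_0)(j)|=|(e^{-itH_Q}v_0)(j)|$ for all $t\in[0,T]$ and all $j\in V$, there is $c\in\mathbb{C}$ with $|c|=1$ such that $u_0=c\,v_0$.
   Context: $G=(V,E)$ is a finite simple undirected graph with $V=\{1,\dots,n\}$. Its combinatorial Laplacian is $\Delta_G u(j)=\sum_{k\sim j}(u(j)-u(k))$ for $u\in\mathbb{C}^V$. A potential $Q\in\mathbb{R}^V$ is identified with the diagonal operator $(Qu)(j)=Q(j)u(j)$, and $H_Q=\Delta_G+Q$. Let $(\phi_k)_{k=1}^n$ be a real orthonormal basis of eigenvectors of $H_Q$, with $H_Q\phi_k=\lambda_k\phi_k$. Condition $B_2$: $\lambda_j+\lambda_k=\lambda_{j'}+\lambda_{k'}$ if and only if $\{j,k\}=\{j',k'\}$ (in particular the eigenvalues are simple). Condition (I): the matrix $(\phi_k(j)^2)_{j,k=1}^n$ is invertible. Condition (S): for every pair $k\neq\ell$ there is $j\in V$ with $\phi_k(j)\phi_\ell(j)\neq0$. *)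

(* Defs.v *)
From HB Require Import structures.
From mathcomp Require Import all_boot all_order all_algebra.
From mathcomp Require Import complex.
From mathcomp Require Import all_classical all_reals all_analysis.

Set Implicit Arguments.
Unset Strict Implicit.
Unset Printing Implicit Defensive.

Import Order.TTheory GRing.Theory Num.Theory.
Import numFieldNormedType.Exports.

Local Open Scope ring_scope.
Local Open Scope complex_scope.

Definition simple_graph (n : nat) (e : rel 'I_n) : Prop :=
  symmetric e /\ irreflexive e.

Definition connected_graph (n : nat) (e : rel 'I_n) : Prop :=
  forall j k : 'I_n, connect e j k.

Definition laplacian (R : realType) (n : nat) (e : rel 'I_n)
    (u : 'cV[R[i]]_n) : 'cV[R[i]]_n :=
  \col_j \sum_(k | e j k) (u j 0 - u k 0).

Definition potential (R : realType) (n : nat) (Q : 'cV[R]_n)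
    (u : 'cV[R[i]]_n) : 'cV[R[i]]_n :=
  \col_j ((Q j 0)%:C * u j 0).

Definition schrodinger_op (R : realType) (n : nat) (e : rel 'I_n)
    (Q : 'cV[R]_n) (u : 'cV[R[i]]_n) : 'cV[R[i]]_n :=
  laplacian e u + potential Q u.

(* e^A u as the sum of the exponential series; [iter m A u] is A^m u.  The
   limit is taken in the topology of C^n (the type ascription with [^o] is only
   there because the library puts the norm topology on R[i]^o, not on R[i]). *)
Definition exp_op (R : realType) (n : nat) (A : 'cV[R[i]]_n -> 'cV[R[i]]_n)
    (u : 'cV[R[i]]_n) : 'cV[R[i]]_n :=
  lim ((fun N : nat =>
          \sum_(m < N) (m`!%:R : R[i])^-1 *: iter m A u : 'cV[R[i]^o]_n)
       @ \oo)%classic.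

Definition propagator (R : realType) (n : nat) (e : rel 'I_n) (Q : 'cV[R]_n)
    (t : R) (u : 'cV[R[i]]_n) : 'cV[R[i]]_n :=
  exp_op (fun w => (- ('i%C * t%:C)) *: schrodinger_op e Q w) u.

(* The index set has n elements, so orthonormality makes [phi] a basis. *)
Definition orthonormal_eigenbasis (R : realType) (n : nat) (e : rel 'I_n)
    (Q : 'cV[R]_n) (phi : 'I_n -> 'cV[R]_n) (lambda : 'I_n -> R) : Prop :=
  (forall k l, \sum_j phi k j 0 * phi l j 0 = (k == l)%:R) /\
  (forall k, schrodinger_op e Q (map_mx (real_complex R) (phi k)) =
             (lambda k)%:C *: map_mx (real_complex R) (phi k)).

Definition condB2 (R : realType) (n : nat) (lambda : 'I_n -> R) : Prop :=
  forall j k j' k' : 'I_n,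
    lambda j + lambda k = lambda j' + lambda k' <->
    [set j; k]%SET = [set j'; k']%SET.

Definition condI (R : realType) (n : nat) (phi : 'I_n -> 'cV[R]_n) : Prop :=
  (\matrix_(j, k) phi k j 0 ^+ 2 : 'M[R]_n) \in unitmx.

Definition condS (R : realType) (n : nat) (phi : 'I_n -> 'cV[R]_n) : Prop :=
  forall k l : 'I_n, k != l -> exists j : 'I_n, phi k j 0 * phi l j 0 != 0.

Definition schrodinger_phase_retrieval (R : realType) (n : nat)
    (e : rel 'I_n) (Q : 'cV[R]_n) (T : R) : Prop :=
  forall u0 v0 : 'cV[R[i]]_n,
    (forall t : R, 0 <= t <= T -> forall j : 'I_n,
       `|propagator e Q t u0 j 0| = `|propagator e Q t v0 j 0|) ->
    exists c : R[i], `|c| = 1 /\ u0 = c *: v0.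

(* Main.v *)
(* Expand u_0 and v_0 in the eigenbasis, with coefficients a_k and b_k.  Then
   |u(t)(j)|^2 - |v(t)(j)|^2 is a trigonometric polynomial in t with frequencies
   lambda_l - lambda_k and coefficients d_kl phi_k(j) phi_l(j), where
   d_kl = a_k conj(a_l) - b_k conj(b_l).  It vanishes on [0, T], so for each
   frequency the sum of its coefficients is 0.  By B_2 the off-diagonal
   frequencies are simple and nonzero: (S) then gives d_kl = 0 for k <> l, and
   the frequency 0 together with (I) gives d_kk = 0.  Hence a a^* = b b^*, that
   is, a and b differ by a phase. *)

From HB Require Import structures.
Require Import Defs.
From mathcomp Require Import all_boot all_order all_algebra.
From mathcomp Require Import complex.
From mathcomp Require Import all_classical all_reals all_analysis.
From mathcomp Require Import ring lra.

Set Implicit Arguments.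
Unset Strict Implicit.
Unset Printing Implicit Defensive.

Import Order.TTheory GRing.Theory Num.Theory.
Import numFieldNormedType.Exports.

Local Open Scope ring_scope.
Local Open Scope complex_scope.

(** * The exponential on the unit circle and its power series *)

Section Cis.
Variable R : realType.
Implicit Types x y : R.

Definition cis x : R[i] := cos x +i* sin x.

Lemma cis0 : cis 0 = 1.
Proof. by rewrite /cis cos0 sin0. Qed.

Lemma cisD x y : cis (x + y) = cis x * cis y.
Proof. by rewrite /cis cosD sinD [sin x * _ + _]addrC. Qed.

Lemma cisN x : cis (- x) = (cis x)^*.
Proof. by rewrite /cis cosN sinN. Qed.

Lemma cisMn x m : cis (x *+ m) = cis x ^+ m.
Proof.
by elim: m => [|m IHm]; rewrite ?mulr0n ?cis0// mulrS cisD IHm exprS.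
Qed.

(** The hypothesis puts the absolute value of [x - y] in [0, pi], where [cos] is injective, and its
    cosine is 1 = [cos 0]. *)
Lemma cis_inj x y : `|x - y| <= pi -> cis x = cis y -> x = y.
Proof.
move=> xy_le eq_xy; have : cis (x - y) = 1.
  by rewrite cisD eq_xy -cisD subrr cis0.
case=> cos_xy _; apply/eqP; rewrite -subr_eq0 -normr_eq0; apply/eqP.
apply: (@cos_inj R); rewrite ?in_itv/= ?normr_ge0 ?lexx ?pi_ge0 ?cos0//.
by case: (ger0P (x - y)) => _; rewrite ?cosN.
Qed.

Local Open Scope classical_set_scope.

Lemma cvg_complex (T : Type) (F : set_system T) (FF : Filter F)
    (f g : T -> R) (a b : R) :
  f x @[x --> F] --> a -> g x @[x --> F] --> b ->
  ((f x +i* g x : R[i]^o) @[x --> F]) --> (a +i* b : R[i]^o).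
Proof.
(* The norm of [R[i]] is itself complex-valued, so the radius is a complex number; being positive,
   it has imaginary part 0. *)
move=> fa gb; apply/(@cvgrPdist_lt _ R[i]^o) => -[eps eps_im].
rewrite ltcE/= => /andP[/eqP eps0 eps_gt0].
have e2 : 0 < eps / 2 by rewrite divr_gt0.
move/cvgrPdist_lt : fa => /(_ _ e2) fa; move/cvgrPdist_lt : gb => /(_ _ e2) gb.
near=> x.
have -> : (a +i* b) - (f x +i* g x) = (a - f x)%:C + 'i * (b - g x)%:C.
  by simpc.
apply: le_lt_trans (ler_normD _ _) _.
rewrite normrM [ `|'i| ](_ : _ = 1) ?mul1r; last first.
  by rewrite normc_def/= expr0n/= add0r expr1n sqrtr1.
rewrite ltcE /= eps0; apply/andP; split; first by simpc.
rewrite !expr0n/= !addr0 !sqrtr_sqr [ltRHS]splitr ltrD//; near: x; assumption.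
Unshelve. all: by end_near. Qed.

(** The parity factors and halved exponents are those of [cos_coeff] and [sin_coeff], so that the
    exponential series splits termwise into cosine and sine series. *)
Lemma exprCi m : ('i : R[i]) ^+ m =
  ((~~ odd m)%:R * (-1) ^+ m./2) +i* ((odd m)%:R * (-1) ^+ m.-1./2).
Proof.
have iE k : ('i : R[i]) ^+ k.*2 = ((-1) ^+ k)%:C.
  by rewrite -mul2n exprM sqr_i rmorphXn rmorphN1.
rewrite -[in LHS](odd_double_half m) -[m in m.-1](odd_double_half m).
case: (odd m) => /=; first by rewrite add1n exprS iE doubleK; simpc.
by rewrite iE; simpc.
Qed.

Lemma cis_coeffE x m : (m`!%:R : R[i])^-1 * ('i * x%:C) ^+ m =
  cos_coeff x m +i* sin_coeff x m.
Proof.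
rewrite exprMn exprCi -rmorphXn /= -[m`!%:R](rmorph_nat (real_complex R)).
rewrite -fmorphV /cos_coeff /sin_coeff /= -exprnP; simpc.
by congr (_ +i* _); ring.
Qed.

Lemma cvg_cis x :
  ((\sum_(m < N) (m`!%:R : R[i])^-1 * ('i * x%:C) ^+ m : R[i]^o)
     @[N --> \oo]) --> (cis x : R[i]^o).
Proof.
have cvgc : series (cos_coeff x) @ \oo --> cos x.
  by rewrite unlock; exact: is_cvg_series_cos_coeff.
have cvgs : series (sin_coeff x) @ \oo --> sin x.
  by rewrite unlock; exact: is_cvg_series_sin_coeff.
suff -> : (fun N => \sum_(m < N) (m`!%:R : R[i])^-1 * ('i * x%:C) ^+ m) =
    (fun N => series (cos_coeff x) N +i* series (sin_coeff x) N).
  exact: cvg_complex cvgc cvgs.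
apply/funext => N; rewrite /series/= !big_mkord.
elim: N => [|N IHN]; first by rewrite !big_ord0.
by rewrite !big_ord_recr/= IHN cis_coeffE.
Qed.

End Cis.

(** * Entrywise limits of matrices *)

(** A neighbourhood of [L] contains a product of neighbourhoods of its entries, and a filter is
    closed under the finite intersection over the indices. *)
Lemma cvg_mx (T : topologicalType) (U : Type) (F : set_system U)
    (FF : Filter F) m n (f : U -> 'M[T]_(m, n)) (L : 'M[T]_(m, n)) :
  (forall i j, (f x i j @[x --> F] --> L i j)%classic) ->
  (f x @[x --> F] --> L)%classic.
Proof.
move=> fL A [P LP PA].
have : (\forall x \near F, forall ij, P ij.1 ij.2 (f x ij.1 ij.2))%classic.
  by apply: filter_forall => ij; apply: fL; exact: LP.
by apply: filterS => x Pfx; apply: PA => i j; exact: (Pfx (i, j)).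
Qed.

Lemma lim_mx_complex (R : realType) m n (f : nat -> 'M[R[i]]_(m, n))
    (L : 'M[R[i]]_(m, n)) :
  (forall i j,
    ((f N i j : R[i]^o) @[N --> \oo] --> (L i j : R[i]^o))%classic) ->
  lim ((f N : 'M[R[i]^o]_(m, n)) @[N --> \oo]%classic) = L.
Proof.
move=> fL; apply: (@cvg_lim (matrix R[i]^o m n : topologicalType)).
  exact: (@norm_hausdorff _ 'M[R[i]^o]_(m, n)).
exact: cvg_mx.
Qed.

(* The trigonometric sum is sampled at multiples t = s m of a step s so small
   that distinct frequencies give distinct nodes cis (s mu); a polynomial that
   vanishes at all nodes but one then isolates that frequency. *)
Lemma trig_sum_eq0 (R : realType) (I : finType) (c : I -> R[i]) (mu : I -> R)
    (T : R) :
  0 < T ->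
  (forall t, 0 <= t <= T -> \sum_p c p * cis (t * mu p) = 0) ->
  forall q, \sum_(p | mu p == mu q) c p = 0.
Proof.
move=> T_gt0 c0 q.
pose M : R := (#|I|.+1)%:R; pose B := \sum_p `|mu p|.
have B_ge0 : 0 <= B by apply: sumr_ge0.
have M_gt0 : 0 < M by rewrite ltr0n.
(* The first bound keeps the samples [s * m], for [m] up to the number of terms, inside [0, T]. The
   second keeps all [s * (mu p - mu q)] within pi, as [cis_inj] asks; the [+ 1] guards against
   [B = 0]. *)
pose s := Num.min (T / M) (pi / (2 * B + 1)).
have B1_gt0 : 0 < 2 * B + 1 by rewrite ltr_wpDl// mulr_ge0.
have s_gt0 : 0 < s by rewrite lt_min !divr_gt0// pi_gt0.
have sM : s * M <= T by rewrite -ler_pdivlMr// ge_min lexx.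
have sB : s * (2 * B + 1) <= pi by rewrite -ler_pdivlMr// ge_min lexx orbT.
pose z p := cis (s * mu p).
have mu_le p : `|mu p| <= B.
  by rewrite /B (bigD1 p)//= lerDl sumr_ge0.
have z_eq p : (z p == z q) = (mu p == mu q).
  apply/eqP/eqP => [/cis_inj zpq|]; last by rewrite /z => ->.
  apply: (mulfI (lt0r_neq0 s_gt0)); apply: zpq.
  rewrite -mulrBr normrM gtr0_norm//; apply: le_trans sB.
  rewrite (ler_wpM2l (ltW s_gt0))//; apply: le_trans (ler_normB _ _) _.
  have := mu_le p; have := mu_le q; lra.
have cX m : (m <= #|I|)%N -> \sum_p c p * z p ^+ m = 0.
  move=> m_le; rewrite -[RHS](c0 (s * m%:R)); last first.
    have s_ge0 := ltW s_gt0; rewrite mulr_ge0//=.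
    apply: le_trans sM; rewrite ler_wpM2l//.
    by rewrite ler_nat leqW.
  apply: eq_bigr => p _; congr (_ * _); rewrite /z -cisMn -mulr_natr.
  by congr cis; ring.
have cP (P : {poly R[i]}) : (size P <= #|I|.+1)%N -> \sum_p c p * P.[z p] = 0.
  move=> sP; under eq_bigr do rewrite horner_coef mulr_sumr.
  rewrite exchange_big big1//= => m _.
  under eq_bigr do rewrite mulrCA.
  by rewrite -mulr_sumr cX ?mulr0// -ltnS (leq_trans _ sP).
pose P : {poly R[i]} := \prod_(p | mu p != mu q) ('X - (z p)%:P).
have sP : (size P <= #|I|.+1)%N.
  have -> : P = \prod_(p <- enum [pred p | mu p != mu q]) ('X - (z p)%:P).
    by rewrite big_enum.
  by rewrite size_prod_XsubC -cardE ltnS max_card.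
have Pq : P.[z q] != 0.
  rewrite horner_prod; apply/prodf_neq0 => p pq.
  by rewrite hornerXsubC subr_eq0 eq_sym z_eq.
(* [P] takes the value [P.[z q]] at every node of frequency [mu q] and 0 at all others. *)
apply: (mulIf Pq); rewrite mul0r -[RHS](cP P sP) mulr_suml.
rewrite [RHS](bigID (fun p => mu p == mu q))/= [X in _ + X]big1 ?addr0.
  by apply: eq_bigr => p; rewrite -z_eq => /eqP ->.
by move=> p pq; rewrite [P](bigD1 p)//= hornerM hornerXsubC subrr mul0r mulr0.
Qed.

(** * Eigenbasis expansion and the propagator *)

Section Spectral.
Variables (R : realType) (n : nat).
Implicit Types (phi : 'I_n -> 'cV[R]_n) (u : 'cV[R[i]]_n).

Local Notation toC := (map_mx (real_complex R)).

(** Orthonormality says that the square matrix [P] with rows [phi k] has right inverse [P^T]; this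
    is also a left inverse, which is completeness. *)
Lemma orthonormal_expansion phi u :
  (forall k l, \sum_j phi k j 0 * phi l j 0 = (k == l)%:R) ->
  exists a : 'I_n -> R[i], u = \sum_k a k *: toC (phi k).
Proof.
move=> phiP; pose P : 'M[R]_n := \matrix_(k, j) phi k j 0.
have PPt : P *m P^T = 1%:M.
  apply/matrixP => k l; rewrite !mxE -phiP; apply: eq_bigr => j _.
  by rewrite !mxE.
pose PC := map_mx (real_complex R) P.
have PtP : PC^T *m PC = 1%:M.
  by rewrite matrix.map_trmx -map_mxM (mulmx1C PPt) map_mx1.
exists (fun k => (PC *m u) k 0).
rewrite -[LHS]mul1mx -PtP -mulmxA; apply/matrixP => j o; rewrite ord1 {o}.
rewrite mxE summxE; apply: eq_bigr => k _.
by rewrite !mxE mulrC.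
Qed.

Lemma schrodinger_op_linear (e : rel 'I_n) (Q : 'cV[R]_n) :
  linear (schrodinger_op e Q).
Proof.
move=> a u v; apply/matrixP => j o; rewrite ord1 {o} !mxE.
under eq_bigr do rewrite !mxE opprD addrACA -mulrBr.
rewrite big_split/= -mulr_sumr; ring.
Qed.

HB.instance Definition _ (e : rel 'I_n) (Q : 'cV[R]_n) :=
  GRing.isLinear.Build R[i] 'cV[R[i]]_n 'cV[R[i]]_n _ (schrodinger_op e Q)
    (schrodinger_op_linear e Q).

(** On each eigenvector the operator series becomes the scalar series of [cis (theta k)]; the finite
    sum over [k] is exchanged with the partial sums and then with the limit. *)
Lemma exp_op_eigensum (A : {linear 'cV[R[i]]_n -> 'cV[R[i]]_n})
    (psi : 'I_n -> 'cV[R[i]]_n) (theta : 'I_n -> R) (a : 'I_n -> R[i]) :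
  (forall k, A (psi k) = ('i * (theta k)%:C) *: psi k) ->
  exp_op A (\sum_k a k *: psi k) = \sum_k (a k * cis (theta k)) *: psi k.
Proof.
move=> Apsi.
have iterA m : iter m A (\sum_k a k *: psi k) =
    \sum_k (a k * ('i * (theta k)%:C) ^+ m) *: psi k.
  elim: m => [|m /= ->]; first by under [RHS]eq_bigr do rewrite expr0 mulr1.
  rewrite linear_sum; apply: eq_bigr => k _ /=.
  by rewrite linearZ/= Apsi scalerA exprSr !mulrA.
rewrite /exp_op; apply: lim_mx_complex => j o; rewrite ord1 {o}.
rewrite (_ : (fun N => _) = fun N => \sum_k (a k * psi k j 0) *
   \sum_(m < N) (m`!%:R : R[i])^-1 * ('i * (theta k)%:C) ^+ m); last first.
  apply/funext => N; rewrite summxE.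
  under [RHS]eq_bigr do rewrite mulr_sumr.
  rewrite [RHS]exchange_big/=; apply: eq_bigr => m _.
  rewrite iterA mxE summxE mulr_sumr; apply: eq_bigr => k _.
  by rewrite mxE; ring.
rewrite summxE [X in (_ --> X)%classic](_ : _ =
  \sum_k (a k * psi k j 0) * cis (theta k)); last first.
  by apply: eq_bigr => k _; rewrite mxE mulrAC.
apply: (cvg_big (op := +%R)) => [|k _].
  exact: (@pseudometric_normed_Zmodule.add_continuous _ R[i]^o).
exact: (@cvgMl_tmp R[i]) (@cvg_cis _ (theta k)).
Qed.

Lemma propagator_eigensum (e : rel 'I_n) (Q : 'cV[R]_n) phi (lambda : 'I_n -> R)
    (t : R) (a : 'I_n -> R[i]) :
  (forall k, schrodinger_op e Q (toC (phi k)) = (lambda k)%:C *: toC (phi k)) ->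
  propagator e Q t (\sum_k a k *: toC (phi k)) =
    \sum_k (a k * cis (- (t * lambda k))) *: toC (phi k).
Proof.
move=> Hphi.
apply: (exp_op_eigensum (A := - ('i * t%:C) \*: schrodinger_op e Q)) => k /=.
by rewrite Hphi scalerA rmorphN rmorphM; congr (_ *: _); ring.
Qed.

End Spectral.

(** * Recovering the phase, and uniqueness of spectral gaps *)

(** If some [b l] is nonzero, the hypothesis at [(k, l)] can be solved for [a k], with a factor
    independent of [k]; its modulus is 1 by the case [(l, l)]. If [b] vanishes, so does [a]. *)
Lemma eq_outer_conj_phase (R : rcfType) (I : finType) (a b : I -> R[i]) :
  (forall k l, a k * (a l)^* = b k * (b l)^*) ->
  exists c : R[i], `|c| = 1 /\ forall k, a k = c * b k.
Proof.
move=> ab; have [l bl|b0] := pickP (fun l => b l != 0); last first.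
  exists 1; split=> [|k]; first exact: normr1.
  have /eqP bk : b k == 0 by apply: negbFE (b0 k).
  by apply/eqP; rewrite bk mulr0 -normr_eq0 -sqrf_eq0 sqr_normc ab bk mul0r.
have al_bl : `|a l| = `|b l|.
  by apply/eqP; rewrite -(@eqrXn2 _ 2)// !sqr_normc ab.
have al : a l != 0 by rewrite -normr_eq0 al_bl normr_eq0.
exists ((b l)^* / (a l)^*); split=> [|k].
  by rewrite normf_div !normcJ al_bl divff// normr_eq0.
by rewrite mulrAC [_ * b k]mulrC -ab mulfK ?conjc_eq0.
Qed.

(** Moving the subtracted terms across turns equal gaps into equal sums, to which B_2 applies. The
    second alternative is the gap 0. *)
Lemma condB2_gap (R : realType) (n : nat) (lambda : 'I_n -> R)
    (k l k' l' : 'I_n) :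
  condB2 lambda -> lambda l - lambda k = lambda l' - lambda k' ->
  (k = k' /\ l = l') \/ (k = l /\ k' = l').
Proof.
move=> B2 eq_gap.
have /B2 /setP eq_set : lambda l + lambda k' = lambda l' + lambda k by lra.
have := eq_set k; have := eq_set l; have := eq_set l'; have := eq_set k'.
rewrite !inE !eqxx ?orbT/=.
move=> /esym/orP[]/eqP k'E /orP[]/eqP l'E /esym/orP[]/eqP lE /orP[]/eqP kE;
  solve [left; split; congruence | right; split; congruence].
Qed.

Theorem theorem1p5 (R : realType) (n : nat) (e : rel 'I_n) (Q : 'cV[R]_n)
    (phi : 'I_n -> 'cV[R]_n) (lambda : 'I_n -> R) (T : R) :
  simple_graph e ->
  connected_graph e ->
  orthonormal_eigenbasis e Q phi lambda ->
  0 < T ->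
  condB2 lambda ->
  condI phi ->
  condS phi ->
  schrodinger_phase_retrieval e Q T.
Proof.
move=> _ _ [orth Hphi] T_gt0 B2 condI_phi condS_phi u0 v0 eq_norm.
have [a u0E] := orthonormal_expansion u0 orth.
have [b v0E] := orthonormal_expansion v0 orth.
pose d k l := a k * (a l)^* - b k * (b l)^*.
have d_sum j k l : \sum_(p | lambda p.2 - lambda p.1 == lambda l - lambda k)
    d p.1 p.2 * (phi p.1 j 0 * phi p.2 j 0)%:C = 0.
  apply: (trig_sum_eq0 (mu := fun p => lambda p.2 - lambda p.1) T_gt0 _ (k, l)).
  move=> t tT.
  (* The value at time [t] and vertex [j] of the solution with initial coefficients [w]. *)
  pose x (w : 'I_n -> R[i]) :=
    \sum_k w k * cis (- (t * lambda k)) * (phi k j 0)%:C.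
  have xE w u : u = \sum_k w k *: map_mx (real_complex R) (phi k) ->
      propagator e Q t u j 0 = x w.
    move=> ->; rewrite (propagator_eigensum _ _ Hphi) summxE.
    by apply: eq_bigr => m _; rewrite !mxE.
  (* Since [phi] is real, conjugation only affects [w] and the [cis] factors, whose product carries
     the gap as frequency. *)
  have xx w : `|x w| ^+ 2 = \sum_p w p.1 * (w p.2)^* *
      (phi p.1 j 0 * phi p.2 j 0)%:C * cis (t * (lambda p.2 - lambda p.1)).
    rewrite sqr_normc /x rmorph_sum mulr_suml.
    under eq_bigr do rewrite mulr_sumr.
    rewrite pair_big/=; apply: eq_bigr => p _.
    have -> (q : 'I_n) : (w q * cis (- (t * lambda q)) * (phi q j 0)%:C)^* =
        (w q)^* * cis (t * lambda q) * (phi q j 0)%:C.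
      rewrite 2!rmorphM cisN.
      by congr (_ * _ * _); [exact: conjcK | exact: conjc_real].
    rewrite mulrBr addrC cisD rmorphM mulrACA.
    by rewrite [in LHS](mulrACA (w _)) [LHS]mulrAC.
  transitivity (`|x a| ^+ 2 - `|x b| ^+ 2).
    rewrite !xx -sumrB; apply: eq_bigr => p _.
    by rewrite /d !mulrBl.
  have := eq_norm t tT j.
  rewrite [X in `|X| = _](xE _ _ u0E) (xE _ _ v0E) => ->.
  by rewrite subrr.
have d_offdiag k l : k != l -> d k l = 0.
  move=> kl; have [j phi_kl] := condS_phi k l kl.
  (* For [k != l], the pair [(k, l)] is the only one with its gap, so the sum has a single term. *)
  have := d_sum j k l; rewrite (big_pred1 (k, l)) => [/eqP|[k' l']/=].
    by rewrite mulf_eq0 fmorph_eq0 (negPf phi_kl) orbF => /eqP.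
  apply/eqP/eqP => [/(condB2_gap B2)|[-> ->]//].
  by case=> [[-> ->]//|[_ eq_kl]]; rewrite eq_kl eqxx in kl.
have d_diag k : d k k = 0.
  pose M := map_mx (real_complex R) (\matrix_(j, k) phi k j 0 ^+ 2 : 'M[R]_n).
  have M_unit : M \in unitmx by rewrite map_unitmx.
  pose D : 'cV[R[i]]_n := \col_k d k k.
  suff : D = 0 by move/matrixP/(_ k 0); rewrite !mxE.
  rewrite -[D](mulKmx M_unit); suff -> : M *m D = 0 by rewrite mulmx0.
  apply/matrixP => j o; rewrite ord1 {o} !mxE -[RHS](d_sum j k k).
  (* The pairs of gap 0 are the diagonal ones, so the sum at frequency 0 is the [j]-th entry of
     [M *m D]. *)
  rewrite (reindex_onto (fun m : 'I_n => (m, m)) fst)/=; last first.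
    move=> [k' l'] /= /eqP /(condB2_gap B2).
    by case=> [[-> ->]|[-> _]].
  apply: eq_big => [m|m _]; first by rewrite !subrr !eqxx.
  by rewrite !mxE mulrC expr2.
have [|c [c1 acb]] := @eq_outer_conj_phase _ _ a b.
  move=> k l; apply/eqP; rewrite -subr_eq0; apply/eqP.
  by case: (eqVneq k l) => [->|/d_offdiag //]; exact: d_diag.
exists c; split=> //; rewrite u0E v0E scaler_sumr.
by apply: eq_bigr => k _; rewrite scalerA acb.
Qed.
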